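(* Let $\varepsilon>0$, let $n,q$ be integers with $q>0$ and $|n|\ll N\to\infty$, and let $C>N^{\varepsilon}$ be a parameter. Let $U\in C_c^\infty(\mathbb{R})$ and $W\in C_c^\infty([-2,-1]\cup[1,2])$ be fixed non-negative even functions, with $W\neq 0$ (not identically zero), such that $U(x)=1$ for $-2\le x\le 2$. Then $$\delta(n=0)=\frac{1}{\mathcal{C}}\sum_{c\ge1}\frac{1}{cq}\sum_{\alpha\ (\mathrm{mod}\ cq)}e\left(\frac{\alpha n}{cq}\right)h\left(\frac{c}{C},\frac{n}{cCq}\right),$$ where $\mathcal{C}=\sum_{c\ge1}W\left(\frac{c}{C}\right)\sim C$ and $$h(x,y)=W(x)U(x)U(y)-W(y)U(x)U(y).$$ In particular, $h$ is a fixed smooth function satisfying $h(x,y)\ll\delta(|x|,|y|\ll1)$.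
   Context: $e(x)=e^{2\pi i x}$. $\delta(\cdot)$ equals $1$ if the condition inside holds and $0$ otherwise. $a\ll b$ means $|a|\le c\,b$ for some constant $c>0$, and $a\sim b$ means $b\ll a\ll b$. The sum over $\alpha$ runs over all residue classes modulo $cq$. The last assertion means that $h$ is bounded and vanishes outside a fixed bounded region of $(x,y)$. *)

(* Defs.v *)
From Stdlib Require Import Reals ZArith ClassicalEpsilon.
From Coquelicot Require Import Coquelicot.
Open Scope R_scope.

Definition e (x : R) : C := (cos (2 * PI * x), sin (2 * PI * x)).

Definition delta (P : Prop) : R :=
  if excluded_middle_informative P then 1 else 0.

Definition smooth (f : R -> R) : Prop :=
  forall (k : nat) (x : R), ex_derive_n f k x.

(* [ex_diff_n h k x y] says that all iterated partial derivatives of [h] of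
   order at most [k], in any order of differentiation, exist and are continuous
   at [(x, y)]; asking it at every point makes [h] of class C^k on the plane. *)
Definition smooth_2d (h : R -> R -> R) : Prop :=
  forall (k : nat) (x y : R), ex_diff_n h k x y.

Definition supp (f : R -> R) : R -> Prop := adherence (fun x => f x <> 0).

Definition Cc_infty (A : R -> Prop) (f : R -> R) : Prop :=
  smooth f /\ compact (supp f) /\ included (supp f) A.

Definition nonneg_fun (f : R -> R) : Prop := forall x, 0 <= f x.

Definition even_fun (f : R -> R) : Prop := forall x, f (- x) = f x.

(* Sums over c >= 1 are indexed by k : nat through c = S k. *)
Definition calC_term (W : R -> R) (X : R) (k : nat) : R := W (INR (S k) / X).

Definition calC (W : R -> R) (X : R) : R := Series (calC_term W X).

Definition h (U W : R -> R) (x y : R) : R :=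
  W x * U x * U y - W y * U x * U y.

(* Residue classes modulo m > 0 are represented by 0, ..., m - 1. *)
Definition sum_mod (m : nat) (f : nat -> C) : C := sum_n f (pred m).

Definition delta_term (U W : R -> R) (n q : Z) (X : R) (k : nat) : C :=
  let c := S k in
  (RtoC (1 / (INR c * IZR q)) *
   sum_mod (c * Z.to_nat q)
     (fun alpha => e (INR alpha * IZR n / (INR c * IZR q)) *
                   RtoC (h U W (INR c / X) (IZR n / (INR c * X * IZR q)))))%C.

(* Main.v *)
(* Summing the characters over [alpha] detects [c q | n].  If [n = 0], the terms
   are [h(c/C, 0) = W(c/C)], which add up to the normalising constant.
   If [n <> 0], only the [c] with [c d q = |n|] for some [d >= 1] survive, and
   such a [c] contributes [h(c/C, d/C)] because [h] is even in its second
   variable; as [h] is antisymmetric, the involution [c <-> d] of the divisors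
   of [|n|/q] cancels the sum. *)

Require Import Defs.
From Stdlib Require Import Reals ZArith.
From Coquelicot Require Import Coquelicot.
From Stdlib Require Import ClassicalEpsilon Lra Lia.
Open Scope R_scope.

(** * Additive characters *)

Lemma e_plus (x y : R) : e (x + y) = (e x * e y)%C.
Proof.
  unfold e, Cmult; simpl.
  replace (2 * PI * (x + y)) with (2 * PI * x + 2 * PI * y) by ring.
  rewrite cos_plus, sin_plus; f_equal; ring.
Qed.

Lemma e_nat (n : nat) : e (INR n) = 1%C.
Proof.
  unfold e, RtoC.
  replace (2 * PI * INR n) with (0 + 2 * INR n * PI) by ring.
  now rewrite cos_period, sin_period, cos_0, sin_0.
Qed.

Lemma e_int (n : Z) : e (IZR n) = 1%C.
Proof.
  destruct (Z_le_gt_dec 0 n) as [Hn | Hn].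
  - rewrite <- (Z2Nat.id n Hn), <- INR_IZR_INZ; apply e_nat.
  - assert (H : (e (IZR n) * e (INR (Z.to_nat (- n))))%C = 1%C).
    { rewrite <- e_plus, INR_IZR_INZ, Z2Nat.id, <- plus_IZR, Z.add_opp_diag_r
        by lia.
      apply (e_nat 0). }
    now rewrite e_nat, Cmult_1_r in H.
Qed.

(** The real part suffices: cos(2 pi x) = 1 - 2 sin(pi x)^2, so sin(pi x) = 0 and pi x is an integer
    multiple of pi. *)
Lemma e_eq_1 (x : R) : e x = 1%C -> exists k : Z, x = IZR k.
Proof.
  intros H; injection H as Hc _.
  replace (2 * PI * x) with (2 * (PI * x)) in Hc by ring.
  rewrite cos_2a_sin in Hc.
  destruct (sin_eq_0_0 (PI * x)) as [k Hk]; [nra |].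
  exists k; apply (Rmult_eq_reg_r PI); [lra | apply PI_neq0].
Qed.

(** Telescoping. The product form avoids a division, so the case [e x = 1] needs no separate
    treatment. *)
Lemma sum_e_geometric (x : R) (m : nat) :
  (sum_n (fun a => e (INR a * x)) m * (1 - e x))%C = (1 - e (INR (S m) * x))%C.
Proof.
  induction m as [| m IH].
  - assert (H0 : e 0 = 1%C) by exact (e_nat 0).
    rewrite sum_O; simpl; rewrite Rmult_0_l, Rmult_1_l, H0; ring.
  - rewrite sum_Sn; change plus with Cplus.
    rewrite Cmult_plus_distr_r, IH, (S_INR (S m)).
    rewrite Rmult_plus_distr_r, Rmult_1_l, e_plus; ring.
Qed.

Lemma sum_mod_e_dvd (m : nat) (n : Z) :
  (0 < m)%nat -> (Z.of_nat m | n)%Z ->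
  sum_mod m (fun a => e (INR a * (IZR n / INR m))) = RtoC (INR m).
Proof.
  intros Hm [k ->]; unfold sum_mod.
  rewrite (sum_n_ext _ (fun _ => RtoC 1)).
  - assert (H : forall N, sum_n (fun _ : nat => RtoC 1) N = RtoC (INR (S N))).
    { induction N as [| N IH].
      - now rewrite sum_O.
      - rewrite sum_Sn, IH, (S_INR (S N)); change plus with Cplus.
        now rewrite <- RtoC_plus. }
    (* The sum up to [pred m] has [S (pred m)] terms, which is [m] because [m] is positive. *)
    rewrite H; do 2 f_equal; lia.
  - intros a; rewrite mult_IZR, <- INR_IZR_INZ.
    replace (INR a * (IZR k * INR m / INR m)) with (IZR (Z.of_nat a * k)).
    + apply e_int.
    + rewrite mult_IZR, <- INR_IZR_INZ; field; apply not_0_INR; lia.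
Qed.

(** The geometric sum times 1 - e(n/m) equals 1 - e(n) = 0, and the factor 1 - e(n/m) is nonzero,
    since otherwise n/m would be an integer. *)
Lemma sum_mod_e_ndvd (m : nat) (n : Z) :
  (0 < m)%nat -> ~ (Z.of_nat m | n)%Z ->
  sum_mod m (fun a => e (INR a * (IZR n / INR m))) = RtoC 0.
Proof.
  intros Hm Hn; unfold sum_mod.
  assert (Hm0 : INR m <> 0) by (apply not_0_INR; lia).
  pose proof (sum_e_geometric (IZR n / INR m) (pred m)) as H.
  replace (S (pred m)) with m in H by lia.
  replace (INR m * (IZR n / INR m)) with (IZR n) in H by (field; easy).
  rewrite e_int in H.
  assert (He : (1 - e (IZR n / INR m))%C <> 0).
  { intros E; apply Hn.
    destruct (e_eq_1 (IZR n / INR m)) as [k Hk].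
    - replace (e (IZR n / INR m)) with (1 - (1 - e (IZR n / INR m)))%C by ring.
      rewrite E; ring.
    - exists k; apply eq_IZR; rewrite mult_IZR, <- INR_IZR_INZ, <- Hk.
      field; easy. }
  destruct (Ceq_dec (sum_n (fun a => e (INR a * (IZR n / INR m))) (pred m)) 0)
    as [Hz | Hz]; [exact Hz |].
  exfalso; apply (Cmult_neq_0 _ _ Hz He); rewrite H; ring.
Qed.

(** * Finite sums and series *)

Lemma sum_n_single {G : AbelianMonoid} (a : nat -> G) (N j : nat) :
  (j <= N)%nat -> (forall i, (i <= N)%nat -> i <> j -> a i = zero) ->
  sum_n a N = a j.
Proof.
  induction N as [| N IH]; intros Hj Ha.
  - now rewrite sum_O; replace j with 0%nat by lia.
  - rewrite sum_Sn; destruct (Nat.eq_dec j (S N)) as [-> | Hne].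
    + rewrite (sum_n_ext_loc _ (fun _ => zero)) by (intros; apply Ha; lia).
      unfold sum_n; rewrite sum_n_m_const_zero; apply plus_zero_l.
    + rewrite IH, (Ha (S N)) by (try (intros; apply Ha); lia).
      apply plus_zero_r.
Qed.

Lemma sum_n_eq_zero {G : AbelianMonoid} (a : nat -> G) (N : nat) :
  (forall i, (i <= N)%nat -> a i = zero) -> sum_n a N = zero.
Proof.
  intros Ha; rewrite (sum_n_ext_loc _ (fun _ => zero)) by easy.
  apply sum_n_m_const_zero.
Qed.

Lemma sum_n_stationary {G : AbelianMonoid} (a : nat -> G) (N M : nat) :
  (forall k, (N < k)%nat -> a k = zero) -> (N <= M)%nat ->
  sum_n a M = sum_n a N.
Proof.
  intros Ha; induction 1 as [| M HM IH]; [easy |].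
  now rewrite sum_Sn, IH, Ha, plus_zero_r by lia.
Qed.

(** The partial sums are eventually constant. The generality covers both the real series [calC] and
    the complex series over the moduli. *)
Lemma is_series_finite {K : AbsRing} {V : NormedModule K} (a : nat -> V)
    (N : nat) :
  (forall k, (N < k)%nat -> a k = zero) -> is_series a (sum_n a N).
Proof.
  intros Ha; unfold is_series.
  apply (filterlim_ext_loc (fun _ => sum_n a N)).
  - exists N; intros M HM; symmetry; now apply sum_n_stationary.
  - apply filterlim_const.
Qed.

Lemma sum_n_RtoC (a : nat -> R) (N : nat) :
  sum_n (fun k => RtoC (a k)) N = RtoC (sum_n a N).
Proof.
  induction N as [| N IH]; [now rewrite !sum_O |].
  rewrite !sum_Sn, IH; change plus with Cplus at 1.
  now rewrite <- RtoC_plus.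
Qed.

Lemma sum_n_nonneg (a : nat -> R) (N : nat) :
  (forall k, 0 <= a k) -> 0 <= sum_n a N.
Proof.
  intros Ha; induction N as [| N IH]; [now rewrite sum_O |].
  rewrite sum_Sn; change plus with Rplus; specialize (Ha (S N)); lra.
Qed.

Lemma sum_n_le_const (a : nat -> R) (M : R) (N : nat) :
  (forall k, a k <= M) -> sum_n a N <= INR (S N) * M.
Proof.
  intros Ha; rewrite <- sum_n_const; now apply sum_n_m_le.
Qed.

(** Counts the indices of the window from [A] to [N] and drops all others. If [A] exceeds [N] the
    left side is at most 0. *)
Lemma sum_n_ge_const (a : nat -> R) (w : R) (A N : nat) :
  0 <= w -> (forall k, 0 <= a k) ->
  (forall k, (A <= k <= N)%nat -> w <= a k) ->
  w * (INR (S N) - INR A) <= sum_n a N.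
Proof.
  intros Hw Ha; induction N as [| N IH]; intros HA.
  - rewrite sum_O; destruct A as [| A].
    + specialize (HA 0%nat ltac:(lia)); simpl; lra.
    + rewrite !S_INR; pose proof (pos_INR A); specialize (Ha 0%nat); simpl; nra.
  - destruct (le_lt_dec A (S N)) as [Hle | Hlt].
    + rewrite sum_Sn; change plus with Rplus; rewrite (S_INR (S N)).
      specialize (IH ltac:(intros; apply HA; lia)).
      specialize (HA (S N) ltac:(lia)); lra.
    + apply (le_INR (S (S N))) in Hlt.
      pose proof (sum_n_nonneg a (S N) Ha); nra.
Qed.

Lemma sum_n_incr (a : nat -> R) (N M : nat) :
  (forall k, 0 <= a k) -> (N <= M)%nat -> sum_n a N <= sum_n a M.
Proof.
  intros Ha; induction 1 as [| M HM IH]; [lra |].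
  rewrite sum_Sn; change plus with Rplus; specialize (Ha (S M)); lra.
Qed.

Lemma sum_n_Ropp (a : nat -> R) (N : nat) :
  sum_n (fun k => - a k) N = - sum_n a N.
Proof.
  induction N as [| N IH]; [now rewrite !sum_O |].
  rewrite !sum_Sn, IH; symmetry; apply Ropp_plus_distr.
Qed.

(** Exchanging the two summations turns the double sum into its own negative. *)
Lemma sum_n_antisym (a : nat -> nat -> R) (N : nat) :
  (forall i j, a j i = - a i j) ->
  sum_n (fun i => sum_n (a i) N) N = 0.
Proof.
  intros Ha.
  assert (H : sum_n (fun i => sum_n (a i) N) N =
              - sum_n (fun i => sum_n (a i) N) N); [| lra].
  rewrite sum_n_switch at 1; rewrite <- sum_n_Ropp.
  apply sum_n_ext; intros i; rewrite <- sum_n_Ropp; now apply sum_n_ext.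
Qed.

(** * Smooth compactly supported functions *)

Lemma smooth_ex_derive (f : R -> R) (x : R) : smooth f -> ex_derive f x.
Proof. intros Hf; exact (Hf 1%nat x). Qed.

Lemma smooth_continuity (f : R -> R) (x : R) : smooth f -> continuity_pt f x.
Proof.
  intros Hf; apply continuity_pt_filterlim.
  exact (ex_derive_continuous f x (smooth_ex_derive f x Hf)).
Qed.

Lemma smooth_Derive (f : R -> R) : smooth f -> smooth (Derive f).
Proof.
  intros Hf [| k] x; [exact I |].
  apply (ex_derive_ext (Derive_n f (k + 1))).
  - intros t; symmetry; apply (Derive_n_comp f k 1).
  - replace (k + 1)%nat with (S k) by lia; exact (Hf (S (S k)) x).
Qed.

Lemma ex_diff_n_ext (f g : R -> R -> R) (k : nat) (x y : R) :
  (forall u v, f u v = g u v) -> ex_diff_n f k x y -> ex_diff_n g k x y.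
Proof.
  intros Hfg; apply ex_diff_n_ext_loc.
  exists (mkposreal 1 Rlt_0_1); intros; apply Hfg.
Qed.

(** Differences of two tensor products of smooth functions are closed under both partial
    derivatives, so induction on the order works once the four factors are generalised. *)
Lemma smooth_2d_tensor_minus (f1 g1 f2 g2 : R -> R) :
  smooth f1 -> smooth g1 -> smooth f2 -> smooth g2 ->
  smooth_2d (fun x y => f1 x * g1 y - f2 x * g2 y).
Proof.
  intros Hf1 Hg1 Hf2 Hg2 k; revert f1 g1 f2 g2 Hf1 Hg1 Hf2 Hg2.
  induction k as [| k IH]; intros f1 g1 f2 g2 Hf1 Hg1 Hf2 Hg2 x y.
  all: assert (Hc : continuity_2d_pt (fun x y => f1 x * g1 y - f2 x * g2 y) x y)
    by (apply continuity_2d_pt_minus; apply continuity_2d_pt_mult;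
        apply continuity_1d_2d_pt_comp;
        auto using smooth_continuity, continuity_2d_pt_id1, continuity_2d_pt_id2).
  - now split.
  - assert (Hx : forall u v, is_derive (fun z => f1 z * g1 v - f2 z * g2 v) u
                   (Derive f1 u * g1 v - Derive f2 u * g2 v)).
    { intros u v; auto_derive; [repeat split; now apply smooth_ex_derive |].
      change (fun x : R => f1 x) with f1; change (fun x : R => f2 x) with f2.
      ring. }
    assert (Hy : forall u v, is_derive (fun z => f1 u * g1 z - f2 u * g2 z) v
                   (f1 u * Derive g1 v - f2 u * Derive g2 v)).
    { intros u v; auto_derive; [repeat split; now apply smooth_ex_derive |].
      change (fun x : R => g1 x) with g1; change (fun x : R => g2 x) with g2.
      ring. }
    split; [exact Hc |]; split; [| split; [| split]].
    + eexists; apply Hx.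
    + eexists; apply Hy.
    + eapply ex_diff_n_ext.
      * intros u v; symmetry; apply is_derive_unique, Hx.
      * apply IH; auto using smooth_Derive.
    + eapply ex_diff_n_ext.
      * intros u v; symmetry; apply is_derive_unique, Hy.
      * apply IH; auto using smooth_Derive.
Qed.

Lemma Cc_infty_in (A : R -> Prop) (f : R -> R) (x : R) :
  Cc_infty A f -> f x <> 0 -> A x.
Proof.
  intros (_ & _ & HA) Hx.
  exact (HA x (adherence_P1 (fun x => f x <> 0) x Hx)).
Qed.

Lemma Cc_infty_vanish (A : R -> Prop) (f : R -> R) :
  Cc_infty A f -> exists B, 0 < B /\ forall x, f x <> 0 -> Rabs x <= B.
Proof.
  intros (_ & Hf & _).
  destruct (compact_P1 _ Hf) as (m & M & HmM).
  (* The bounds [m] and [M] of the support may have any sign; the added 1 makes the radius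
     positive. *)
  exists (Rabs m + Rabs M + 1).
  pose proof (Rabs_pos m); pose proof (Rabs_pos M).
  split; [lra |].
  intros x Hx; specialize (HmM x (adherence_P1 (fun x => f x <> 0) x Hx)).
  pose proof (Rle_abs M); pose proof (Rle_abs (- m)).
  rewrite Rabs_Ropp in *; apply Rabs_le; lra.
Qed.

(** By continuity |f| attains a maximum on an interval outside which f vanishes. *)
Lemma Cc_infty_bounded (A : R -> Prop) (f : R -> R) :
  Cc_infty A f -> exists M, 0 < M /\ forall x, Rabs (f x) <= M.
Proof.
  intros Hf; destruct (Cc_infty_vanish A f Hf) as (B & HB & HfB).
  destruct (continuity_ab_maj (fun x => Rabs (f x)) (- B) B) as (z & Hz & _).
  - lra.
  - intros c _; apply (continuity_pt_comp f Rabs); [| apply Rcontinuity_abs].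
    apply smooth_continuity, Hf.
  - exists (Rabs (f z) + 1); pose proof (Rabs_pos (f z)); split; [lra |].
    intros x; destruct (Req_dec (f x) 0) as [Hx | Hx].
    + rewrite Hx, Rabs_R0; lra.
    + apply HfB, Rabs_le_between in Hx; specialize (Hz x Hx); simpl in Hz; lra.
Qed.

Lemma even_fun_Rabs (f : R -> R) (x : R) : even_fun f -> f (Rabs x) = f x.
Proof.
  intros Hf; unfold Rabs; destruct (Rcase_abs x); auto.
Qed.

(** * The normalising constant *)

Section Normalisation.

Variable W : R -> R.
Hypothesis HW : Cc_infty (fun x => -2 <= x <= -1 \/ 1 <= x <= 2) W.

Lemma calC_term_vanish (X : R) (k : nat) :
  0 < X -> 2 * X < INR (S k) -> calC_term W X k = 0.
Proof.
  intros HX Hk; unfold calC_term.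
  destruct (Req_dec (W (INR (S k) / X)) 0) as [H | H]; [exact H |].
  apply (Cc_infty_in _ _ _ HW) in H.
  assert (2 < INR (S k) / X) by (apply Rlt_div_r; lra).
  lra.
Qed.

Lemma calC_cutoff (X : R) :
  0 < X -> exists N : nat, INR N <= 2 * X /\
    forall k, (N < k)%nat -> calC_term W X k = 0.
Proof.
  (* [N] is the floor of 2X. The index k stands for c = k + 1, so k > N gives c > N + 1 > 2X. *)
  intros HX; destruct (nfloor_ex (2 * X)) as (N & HN); [lra |].
  exists N; split; [lra |]; intros k Hk.
  apply calC_term_vanish; [exact HX |].
  apply lt_INR in Hk; rewrite S_INR; lra.
Qed.

Lemma calC_eq_sum_n (X : R) (N : nat) :
  (forall k, (N < k)%nat -> calC_term W X k = 0) ->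
  calC W X = sum_n (calC_term W X) N.
Proof.
  intros HN; apply is_series_unique.
  exact (is_series_finite (V := R_NormedModule) _ N HN).
Qed.

Lemma ex_series_calC_term (X : R) : 0 < X -> ex_series (calC_term W X).
Proof.
  intros HX; destruct (calC_cutoff X HX) as (N & _ & HN).
  eexists; exact (is_series_finite (V := R_NormedModule) _ N HN).
Qed.

Hypothesis W_nonneg : nonneg_fun W.

Lemma calC_term_nonneg (X : R) (k : nat) : 0 <= calC_term W X k.
Proof. apply W_nonneg. Qed.

(** At most 2X + 1 terms remain, hence at most 3X since X >= 1, and each is at most [M]. *)
Lemma calC_upper (M X : R) :
  0 <= M -> (forall x, Rabs (W x) <= M) -> 1 <= X ->
  Rabs (calC W X) <= 3 * M * X.
Proof.
  intros HM0 HM HX.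
  destruct (calC_cutoff X) as (N & HNX & HN); [lra |].
  rewrite (calC_eq_sum_n X N HN), Rabs_pos_eq
    by (apply sum_n_nonneg, calC_term_nonneg).
  apply Rle_trans with (INR (S N) * M).
  - apply sum_n_le_const; intros k.
    eapply Rle_trans; [apply Rle_abs | apply HM].
  - rewrite S_INR; nra.
Qed.

Hypothesis W_even : even_fun W.

(** Evenness moves a point where [W] is nonzero to the positive half-line, where the support forces
    it to be at least 1; by continuity [W] keeps half of its value nearby. *)
Lemma pos_lower_bound :
  (exists x, W x <> 0) ->
  exists x0 r w, 0 < r <= 1 /\ 1 <= x0 /\ 0 < w /\
    forall x, Rabs (x - x0) < r -> w <= W x.
Proof.
  intros (x & Hx); rewrite <- (even_fun_Rabs W) in Hx by exact W_even.
  set (x0 := Rabs x) in *.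
  assert (Hx0 : 1 <= x0).
  { assert (0 <= x0) by apply Rabs_pos.
    apply (Cc_infty_in _ _ _ HW) in Hx; lra. }
  assert (Hpos : 0 < W x0) by (specialize (W_nonneg x0); lra).
  destruct HW as (Hs & _ & _).
  pose proof (proj1 (continuity_pt_locally W x0) (smooth_continuity W x0 Hs)
                (mkposreal (W x0 / 2) ltac:(lra))) as (d & Hd).
  pose proof (cond_pos d).
  (* Capping the radius at 1 keeps x0 - r/2 positive, as the count of moduli in [calC_lower]
     requires. *)
  exists x0, (Rmin d 1), (W x0 / 2).
  pose proof (Rmin_l d 1); pose proof (Rmin_r d 1).
  assert (0 < Rmin d 1) by (apply Rmin_glb_lt; lra).
  repeat split; try lra.
  intros y Hy; specialize (Hd y ltac:(change (Rabs (y - x0) < d); lra)).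
  simpl in Hd; apply Rabs_lt_between in Hd; lra.
Qed.

(** More than rX - 1 integers c satisfy |c/X - x0| <= r/2, each contributing at least [w]; and rX -
    1 >= rX/2 because rX >= 2. *)
Lemma calC_lower (x0 r w X : R) :
  0 < r <= 1 -> 1 <= x0 -> 0 < w ->
  (forall x, Rabs (x - x0) < r -> w <= W x) ->
  1 <= X -> 2 / r <= X -> w * r / 2 * X <= calC W X.
Proof.
  intros Hr Hx0 Hw HrW HX HrX.
  assert (HrX' : 2 <= r * X).
  { apply Rmult_le_compat_l with (r := r) in HrX; [| lra].
    replace (r * (2 / r)) with 2 in HrX by (field; lra); lra. }
  (* Once the upper floor is written as [S B], the indices k from [A] to [B] stand for the integers
     c = k + 1 with (x0 - r/2)X < c <= (x0 + r/2)X. *)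
  destruct (nfloor_ex ((x0 - r / 2) * X)) as (A & HA); [nra |].
  destruct (nfloor_ex ((x0 + r / 2) * X)) as (B & HB); [nra |].
  destruct B as [| B]; [simpl in HB; nra |].
  destruct (calC_cutoff X) as (N & HNX & HN); [lra |].
  (* This partial sum is long enough both to equal the whole series and to contain the window. *)
  rewrite (calC_eq_sum_n X (max B N)) by (intros; apply HN; lia).
  apply Rle_trans with (sum_n (calC_term W X) B).
  - eapply Rle_trans;
      [| apply (sum_n_ge_const _ w A); [lra | apply calC_term_nonneg |]].
    + apply Rle_trans with (w * (r * X - 1)); [nra |].
      apply Rmult_le_compat_l; lra.
    + intros k [HAk HkB]; apply HrW.
      apply le_INR in HAk; apply le_INR in HkB.
      rewrite S_INR in HB; rewrite S_INR.
      set (t := (INR k + 1) / X).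
      assert (Ht : t * X = INR k + 1) by (unfold t; field; lra).
      apply Rabs_lt_between'; split; apply (Rmult_lt_reg_r X); nra.
  - apply sum_n_incr; [apply calC_term_nonneg | lia].
Qed.

End Normalisation.

(** * The sum over moduli *)

Section Moduli.

Variables (U W : R -> R).
Hypothesis HU : Cc_infty (fun _ => True) U.
Hypothesis HW : Cc_infty (fun x => -2 <= x <= -1 \/ 1 <= x <= 2) W.
Hypothesis U_one : forall x, -2 <= x <= 2 -> U x = 1.

Lemma W_mul_U (x : R) : W x * U x = W x.
Proof.
  destruct (Req_dec (W x) 0) as [-> | Hx]; [ring |].
  rewrite U_one; [ring |].
  apply (Cc_infty_in _ _ _ HW) in Hx; lra.
Qed.

(** Since [U] is 1 on the support of [W], one factor [U] is absorbed in each product; this gives the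
    form to which [smooth_2d_tensor_minus] applies. *)
Lemma h_tensor (x y : R) : h U W x y = W x * U y - U x * W y.
Proof.
  unfold h; rewrite W_mul_U.
  replace (W y * U x * U y) with (U x * (W y * U y)) by ring.
  now rewrite W_mul_U.
Qed.

Lemma h_antisym (x y : R) : h U W y x = - h U W x y.
Proof. unfold h; ring. Qed.

(** Here U(0) = 1, while W(0) = 0 because the support of [W] avoids the origin. *)
Lemma h_0_r (x : R) : h U W x 0 = W x.
Proof.
  rewrite h_tensor, U_one by lra.
  destruct (Req_dec (W 0) 0) as [-> | H0]; [ring |].
  apply (Cc_infty_in _ _ _ HW) in H0; lra.
Qed.

Lemma smooth_2d_h : smooth_2d (h U W).
Proof.
  intros k x y.
  apply (ex_diff_n_ext (fun x y => W x * U y - U x * W y)).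
  - intros; symmetry; apply h_tensor.
  - apply smooth_2d_tensor_minus; first [apply HU | apply HW].
Qed.

(** Both products in [h] contain U(x)U(y), so the support of [U] alone fixes the square; the size is
    read off the tensor form. *)
Lemma h_bounded_support :
  exists M B : R, 0 < M /\ 0 < B /\
    forall x y, Rabs (h U W x y) <= M * delta (Rabs x <= B /\ Rabs y <= B).
Proof.
  destruct (Cc_infty_vanish _ _ HU) as (B & HB & HUB).
  destruct (Cc_infty_bounded _ _ HU) as (MU & HMU & HUM).
  destruct (Cc_infty_bounded _ _ HW) as (MW & HMW & HWM).
  exists (MW * MU + MU * MW), B.
  split; [nra | split; [exact HB |]]; intros x y; unfold delta.
  destruct (excluded_middle_informative _) as [_ | Hxy].
  - rewrite h_tensor, Rmult_1_r; unfold Rminus.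
    eapply Rle_trans; [apply Rabs_triang |].
    rewrite Rabs_Ropp, !Rabs_mult.
    apply Rplus_le_compat; apply Rmult_le_compat; auto using Rabs_pos.
  - assert (H0 : h U W x y = 0).
    { unfold h; destruct (Req_dec (U x) 0) as [-> | Hx]; [ring |].
      destruct (Req_dec (U y) 0) as [-> | Hy]; [ring |].
      exfalso; auto. }
    rewrite H0, Rabs_R0; lra.
Qed.

(** * Evaluation of the term of a single modulus *)

Lemma INR_modulus (q : Z) (k : nat) :
  (0 < q)%Z -> INR (S k * Z.to_nat q) = INR (S k) * IZR q.
Proof.
  intros Hq; rewrite mult_INR, (INR_IZR_INZ (Z.to_nat q)), Z2Nat.id by lia.
  reflexivity.
Qed.

(** The value of [h] does not depend on the residue class, so it leaves the sum and a complete
    character sum modulo cq remains. *)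
Lemma delta_term_factor (n q : Z) (X : R) (k : nat) :
  (0 < q)%Z ->
  let m := (S k * Z.to_nat q)%nat in
  delta_term U W n q X k =
  (RtoC (1 / INR m) *
   (sum_mod m (fun a => e (INR a * (IZR n / INR m))) *
    RtoC (h U W (INR (S k) / X) (IZR n / (INR (S k) * X * IZR q)))))%C.
Proof.
  intros Hq m; unfold delta_term, m; cbv zeta.
  rewrite INR_modulus by exact Hq; f_equal.
  etransitivity; [| exact (sum_n_mult_r (K := C_Ring) _ _ _)].
  apply sum_n_ext; intros a; change mult with Cmult; do 2 f_equal.
  unfold Rdiv; ring.
Qed.

Lemma delta_term_dvd (n q : Z) (X : R) (k : nat) :
  (0 < q)%Z -> (Z.of_nat (S k) * q | n)%Z ->
  delta_term U W n q X k =
  RtoC (h U W (INR (S k) / X) (IZR n / (INR (S k) * X * IZR q))).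
Proof.
  intros Hq Hdvd; rewrite delta_term_factor by exact Hq.
  assert (Hm : (0 < S k * Z.to_nat q)%nat) by nia.
  rewrite sum_mod_e_dvd; [| exact Hm |].
  - rewrite <- !RtoC_mult; f_equal.
    field; apply not_0_INR; lia.
  - now rewrite Nat2Z.inj_mul, Z2Nat.id by lia.
Qed.

Lemma delta_term_ndvd (n q : Z) (X : R) (k : nat) :
  (0 < q)%Z -> ~ (Z.of_nat (S k) * q | n)%Z ->
  delta_term U W n q X k = RtoC 0.
Proof.
  intros Hq Hdvd; rewrite delta_term_factor by exact Hq.
  assert (Hm : (0 < S k * Z.to_nat q)%nat) by nia.
  rewrite sum_mod_e_ndvd; [ring | exact Hm |].
  now rewrite Nat2Z.inj_mul, Z2Nat.id by lia.
Qed.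

Lemma is_series_delta_term_0 (q : Z) (X : R) :
  (0 < q)%Z -> 0 < X ->
  is_series (delta_term U W 0 q X) (RtoC (calC W X)).
Proof.
  intros Hq HX.
  assert (HT : forall k, delta_term U W 0 q X k = RtoC (calC_term W X k)).
  { intros k; rewrite delta_term_dvd by auto using Z.divide_0_r.
    unfold Rdiv at 2; rewrite Rmult_0_l, h_0_r; reflexivity. }
  destruct (calC_cutoff W HW X HX) as (N & _ & HN).
  rewrite (calC_eq_sum_n W X N HN), <- sum_n_RtoC.
  rewrite (sum_n_ext _ (delta_term U W 0 q X)) by (intros; now rewrite HT).
  apply (is_series_finite (V := C_NormedModule)); intros k Hk; now rewrite HT, HN.
Qed.

(** * Complementary divisors and cancellation for nonzero n *)

Hypothesis U_even : even_fun U.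
Hypothesis W_even : even_fun W.

Lemma h_Rabs_r (x y : R) : h U W x (Rabs y) = h U W x y.
Proof. unfold h; now rewrite !even_fun_Rabs. Qed.

(** Pairs (c, d) with c d q = |n| are placed in an array padded with zeros, so that the divisor
    involution becomes transposition of the indices. *)
Definition divisor_pair_term (n q : Z) (X : R) (i j : nat) : R :=
  if Z.eq_dec (Z.of_nat (S i) * Z.of_nat (S j) * q) (Z.abs n)
  then h U W (INR (S i) / X) (INR (S j) / X) else 0.

Lemma divisor_pair_term_antisym (n q : Z) (X : R) (i j : nat) :
  divisor_pair_term n q X j i = - divisor_pair_term n q X i j.
Proof.
  unfold divisor_pair_term.
  rewrite (Z.mul_comm (Z.of_nat (S j))).
  destruct (Z.eq_dec _ _); [apply h_antisym | ring].
Qed.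

(** For a given c at most one d satisfies c d q = |n|, so a row of the array has at most one nonzero
    entry. Evenness in the second variable replaces n by |n|, and |n|/(cXq) = d/X. *)
Lemma delta_term_divisor_pairs (n q : Z) (X : R) (k : nat) :
  (0 < q)%Z -> n <> 0%Z -> 0 < X ->
  delta_term U W n q X k =
  RtoC (sum_n (divisor_pair_term n q X k) (pred (Z.abs_nat n))).
Proof.
  intros Hq Hn HX.
  destruct (Znumtheory.Zdivide_dec (Z.of_nat (S k) * q) n) as [Hd | Hd].
  - rewrite delta_term_dvd by assumption; f_equal.
    destruct (proj2 (Z.divide_abs_r _ _) Hd) as [d Hn'].
    assert (Hd0 : (0 < d)%Z) by nia.
    set (j := pred (Z.to_nat d)).
    assert (Hj : Z.of_nat (S j) = d) by (unfold j; lia).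
    rewrite (sum_n_single _ _ j).
    + unfold divisor_pair_term; rewrite Hj.
      destruct (Z.eq_dec _ _) as [_ | H]; [| nia].
      rewrite <- h_Rabs_r; f_equal.
      assert (0 < INR (S k)) by (apply lt_0_INR; lia).
      assert (0 < IZR q) by now apply (IZR_lt 0).
      assert (0 < INR (S k) * X * IZR q)
        by (repeat apply Rmult_lt_0_compat; assumption).
      rewrite Rabs_div, <- abs_IZR, Hn', (Rabs_pos_eq (INR (S k) * X * IZR q))
        by lra.
      rewrite !mult_IZR, <- INR_IZR_INZ, <- Hj, <- INR_IZR_INZ.
      field; repeat split; lra.
    (* The index of d is d - 1, hence within the summation range. *)
    + assert (d <= Z.abs n)%Z by nia. lia.
    + intros i _ Hi; unfold divisor_pair_term.
      destruct (Z.eq_dec _ _) as [H | _]; [| reflexivity].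
      exfalso; apply Hi; assert (Z.of_nat (S i) = d) by nia; lia.
  - rewrite delta_term_ndvd by assumption; f_equal; symmetry.
    apply (sum_n_eq_zero (divisor_pair_term n q X k)).
    intros j _; unfold divisor_pair_term.
    destruct (Z.eq_dec _ _) as [H | _]; [| reflexivity].
    exfalso; apply Hd, Z.divide_abs_r; rewrite <- H.
    exists (Z.of_nat (S j)); ring.
Qed.

(** For c > |n| the product cq cannot divide n, so the series is the sum of an antisymmetric square
    array of side |n|. *)
Lemma is_series_delta_term_neq0 (n q : Z) (X : R) :
  (0 < q)%Z -> n <> 0%Z -> 0 < X ->
  is_series (delta_term U W n q X) (RtoC 0).
Proof.
  intros Hq Hn HX.
  rewrite <- (sum_n_antisym (divisor_pair_term n q X) (pred (Z.abs_nat n)))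
    by (intros; apply divisor_pair_term_antisym).
  rewrite <- sum_n_RtoC, (sum_n_ext _ (delta_term U W n q X))
    by (intros; now rewrite delta_term_divisor_pairs).
  apply (is_series_finite (V := C_NormedModule)); intros k Hk.
  apply delta_term_ndvd; [exact Hq |].
  intros Hd; apply Z.divide_abs_r, Z.divide_pos_le in Hd; nia.
Qed.

End Moduli.

(** * Growth of the parameter and assembly of the result *)

Lemma Rpower_eventually_ge (eps T : R) :
  0 < eps -> Rbar_locally p_infty (fun N => T <= Rpower N eps).
Proof.
  intros Heps.
  (* The maximum makes the bound positive, so that its logarithm can be inverted; the threshold for
     N is then T' to the power 1/eps. *)
  set (T' := Rmax T 1).
  assert (HT : 0 < T') by (unfold T'; pose proof (Rmax_r T 1); lra).
  exists (exp (ln T' / eps)); intros N HN.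
  apply Rle_trans with T'; [apply Rmax_l |].
  unfold Rpower; rewrite <- (exp_ln T' HT).
  left; apply exp_increasing.
  rewrite Rmult_comm; apply Rlt_div_l; [lra |].
  rewrite <- (ln_exp (ln T' / eps)).
  apply ln_increasing; [apply exp_pos | exact HN].
Qed.

Theorem corollaryA1p1 :
  forall (eps : R) (U W : R -> R),
    0 < eps ->
    Cc_infty (fun _ => True) U ->
    Cc_infty (fun x => -2 <= x <= -1 \/ 1 <= x <= 2) W ->
    nonneg_fun U -> nonneg_fun W ->
    even_fun U -> even_fun W ->
    (exists x, W x <> 0) ->
    (forall x, -2 <= x <= 2 -> U x = 1) ->
    (exists c1 c2 : R, 0 < c1 /\ 0 < c2 /\
      forall K : R, 0 < K ->
        Rbar_locally p_infty (fun N : R =>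
          forall (n q : Z) (X : R),
            (0 < q)%Z ->
            Rabs (IZR n) <= K * N ->
            Rpower N eps < X ->
            (exists S : C,
               is_series (delta_term U W n q X) S /\
               RtoC (delta (n = 0%Z)) = (RtoC (1 / calC W X) * S)%C) /\
            ex_series (calC_term W X) /\
            Rabs (calC W X) <= c2 * X /\
            Rabs X <= c1 * calC W X)) /\
    smooth_2d (h U W) /\
    (exists M B : R, 0 < M /\ 0 < B /\
      forall x y : R,
        Rabs (h U W x y) <= M * delta (Rabs x <= B /\ Rabs y <= B)).
Proof.
  intros eps U W Heps HU HW _ W_nonneg U_even W_even HW0 U_one.
  split; [| split; [now apply smooth_2d_h | now apply h_bounded_support]].
  destruct (Cc_infty_bounded _ _ HW) as (M & HM & HWM).
  destruct (pos_lower_bound W HW W_nonneg W_even HW0)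
    as (x0 & r & w & Hr & Hx0 & Hw & Hlow).
  assert (Hwr : 0 < w * r / 2) by nra.
  (* The inverse of the constant in [calC_lower], and the constant in [calC_upper]. *)
  exists (/ (w * r / 2)), (3 * M).
  split; [now apply Rinv_0_lt_compat | split; [lra |]].
  intros K _.
  (* For such N every X > N^eps exceeds both 1 and 2/r, the ranges in which the two bounds on [calC]
     hold. *)
  apply (filter_imp (fun N => Rmax 1 (2 / r) <= Rpower N eps));
    [| now apply Rpower_eventually_ge].
  intros N HN n q X Hq _ HNX.
  pose proof (Rmax_l 1 (2 / r)); pose proof (Rmax_r 1 (2 / r)).
  assert (HX : 0 < X) by lra.
  assert (HC : w * r / 2 * X <= calC W X)
    by (apply (calC_lower W HW W_nonneg x0 r w X); auto; lra).
  assert (HCpos : 0 < calC W X) by nra.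
  split; [| split; [| split]].
  - destruct (Z.eq_dec n 0) as [-> | Hn].
    + exists (RtoC (calC W X)); split; [now apply is_series_delta_term_0 |].
      rewrite <- RtoC_mult; f_equal; unfold delta.
      destruct (excluded_middle_informative _); [field; lra | easy].
    + exists (RtoC 0); split; [now apply is_series_delta_term_neq0 |].
      rewrite Cmult_0_r; f_equal; unfold delta.
      now destruct (excluded_middle_informative _).
  - now apply ex_series_calC_term.
  - apply calC_upper; auto; lra.
  - rewrite Rabs_pos_eq, Rmult_comm by lra.
    apply Rle_div_r; [now apply Rlt_gt |]. lra.
Qed.
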